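(* Let $T$ be a finite tree and let $w$ be a positive weight function on $V(T)$. Then $$\gamma_w(T)=s_w(T),\qquad\text{where } s_w(T)=\max_{v\in V(T)} s_w(v)\ \text{ and }\ s_w(v)=\sum_{u\in V(T)} w(u)\cdot 2^{d(u,v)}.$$
   Context: Here $d(u,v)$ denotes the distance from $u$ to $v$ in $T$. A configuration of pebbles on a graph $G$ assigns a nonnegative integer number of pebbles to each vertex; its size is the total number of pebbles. A pebbling move consists of taking two pebbles off of one vertex (which must have at least two) and placing one pebble on an adjacent vertex. A weight function $w$ assigns an integer $w(v)$ to each vertex $v$; it is positive if $w(v)>0$ for all $v$. The weighted cover pebbling number $\gamma_w(G)$ of a finite connected graph $G$ is the minimum number $k$ such that from every initial configuration with $k$ pebbles there is a (possibly empty) sequence of pebbling moves after which every vertex $v$ simultaneously has at least $w(v)$ pebbles on it. *)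

(* Defs.v *)
From mathcomp Require Import all_boot all_order all_algebra.
From mathcomp Require Import boolp.

Set Implicit Arguments.
Unset Strict Implicit.
Unset Printing Implicit Defensive.

Import Order.TTheory GRing.Theory Num.Theory.
Local Open Scope ring_scope.

Record sgraph := SGraph {
  vertex :> finType;
  adj : rel vertex;
  adj_sym : symmetric adj;
  adj_irrefl : irreflexive adj
}.

Definition connected (G : sgraph) : Prop :=
  (0 < #|G|)%N /\ forall u v : G, connect (@adj G) u v.

Record cgraph := CGraph {
  cgraph_base :> sgraph;
  cgraph_connected : connected cgraph_base
}.

(* The bound on the size of [c] is needed because [ucycle] also accepts the
   empty cycle and the closed walk of length 2 along a single edge. *)
Definition acyclic (G : sgraph) : Prop :=
  forall c : seq G, (2 < size c)%N -> ~ ucycle (@adj G) c.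

Record tree := Tree {
  tree_base :> cgraph;
  tree_acyclic : acyclic tree_base
}.

Definition walk_of_length (G : sgraph) (u v : G) (n : nat) : bool :=
  [exists p : n.-tuple G, path (@adj G) u p && (last u p == v)].

Lemma walk_exists (G : cgraph) (u v : G) : exists n, walk_of_length u v n.
Proof.
have [_ /(_ u v)/connectP[p pth ->]] := cgraph_connected G.
by exists (size p); apply/existsP; exists (in_tuple p); rewrite pth eqxx.
Qed.

Definition dist (G : cgraph) (u v : G) : nat := ex_minn (walk_exists u v).

Definition config (G : sgraph) := {ffun G -> nat}.

Definition config_size (G : sgraph) (c : config G) : nat := (\sum_v c v)%N.

Definition pebbling_move (G : sgraph) : rel (config G) := fun c c' =>
  [exists u, exists v, [&& adj u v, (2 <= c u)%N &
    c' == [ffun x => (c x - (x == u).*2 + (x == v))%N]]].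

Definition covers (G : sgraph) (w : G -> int) (c : config G) : Prop :=
  forall v, w v <= (c v)%:Z.

Definition coverable (G : sgraph) (w : G -> int) (c : config G) : Prop :=
  exists2 s : seq (config G),
    path (@pebbling_move G) c s & covers w (last c s).

Definition cover_sufficient (G : sgraph) (w : G -> int) (k : nat) : Prop :=
  forall c : config G, config_size c = k -> coverable w c.

Section Existence.
Variable G : cgraph.
Implicit Types (a b c d : config G) (u v x : G).

Let reach c c' :=
  exists2 s : seq (config G), path (@pebbling_move G) c s & last c s = c'.

Let pile v : config G := [ffun x => (x == v) : nat].

Let reach_refl c : reach c c. Proof. by exists [::]. Qed.

Let reach_trans a b c : reach a b -> reach b c -> reach a c.
Proof.
move=> [s sP <-] [t tP <-]; exists (s ++ t); last by rewrite last_cat.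
by rewrite cat_path sP.
Qed.

Let moveD a b d : pebbling_move a b -> pebbling_move (a + d) (b + d).
Proof.
case/existsP=> u /existsP[v /and3P[uv au /eqP->]].
apply/existsP; exists u; apply/existsP; exists v; rewrite uv ffunE /=.
rewrite (leq_trans au) ?leq_addr //=; apply/eqP/ffunP=> x; rewrite !ffunE.
rewrite [LHS]addnAC addnBAC //.
by case: eqP => // ->.
Qed.

Let reachDr a b d : reach a b -> reach (a + d) (b + d).
Proof.
case=> s; elim: s a => [|c s IH] a /=; first by move=> _ ->.
case/andP=> ac sP lst; apply: reach_trans (IH c sP lst).
by exists [:: c + d] => //=; rewrite moveD.
Qed.

Let reachD a b a' b' : reach a b -> reach a' b' -> reach (a + a') (b + b').
Proof.
move=> ab ab'; apply: (reach_trans (reachDr a' ab)).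
by rewrite ![b + _]addrC; apply: reachDr.
Qed.

Let reachMn a b n : reach a b -> reach (a *+ n) (b *+ n).
Proof.
by move=> ab; elim: n => [|n IH]; rewrite ?mulr0n ?mulrS //; apply: reachD.
Qed.

Let reach_pile v p : path (@adj G) v p ->
  reach (pile v *+ 2 ^ size p) (pile (last v p)).
Proof.
elim: p v => [|x p IH] v /=; first by rewrite expn0 mulr1n.
case/andP=> vx /IH; apply: reach_trans; rewrite expnS mulrnA.
apply: reachMn; exists [:: pile x] => //=; rewrite andbT.
apply/existsP; exists v; apply/existsP; exists x; rewrite vx mulr2n !ffunE eqxx.
apply/eqP/ffunP=> y; rewrite !ffunE.
by case: eqP => //= _; case: eqP.
Qed.

Lemma cover_sufficient_exists (w : G -> int) :
  exists k, `[< cover_sufficient w k >].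
Proof.
pose need v := (\sum_u 2 ^ dist v u * `|w u|)%N.
exists (\sum_v need v)%N; apply/asboolP=> c szc.
have [v cv] : exists v, (need v <= c v)%N.
  apply/existsP; apply: contraT; rewrite negb_exists => /forallP small.
  have : (\sum_v (c v).+1 <= \sum_v need v)%N.
    by apply: leq_sum => v _; rewrite ltnNge small.
  rewrite -szc /config_size.
  under eq_bigr => v _ do rewrite -addn1.
  rewrite big_split /= sum1_card -[leqRHS]addn0 leq_add2l leqn0 => /eqP G0.
  by have [] := cgraph_connected G; rewrite G0.
pose goal : config G := \sum_u pile u *+ `|w u|.
have goalE u : goal u = `|w u|%N.
  rewrite /goal sum_ffunE (bigD1 u) //= big1 => [|x xu].
    by rewrite ffunMnE ffunE eqxx addr0 natn.
  by rewrite ffunMnE ffunE eq_sym (negbTE xu) mul0rn.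
have to_goal : reach (pile v *+ need v) goal.
  rewrite /need /goal -sumrMnr.
  elim/big_ind2: _ => [||u _]; [exact: reach_refl | by move=> *; apply: reachD |].
  rewrite mulrnA; apply: reachMn; rewrite /dist; case: ex_minnP => n + _.
  case/existsP=> p /andP[pth /eqP <-].
  by have := reach_pile pth; rewrite size_tuple.
pose rest : config G := [ffun x => (c x - (pile v *+ need v) x)%N].
have cE : c = pile v *+ need v + rest.
  apply/ffunP=> x; rewrite !ffunE /= [RHS]subnKC //.
  rewrite ffunMnE ffunE; case: eqP => [->|_]; last by rewrite mul0rn.
  by rewrite natn.
have := reachDr rest to_goal; rewrite -cE => -[s sP lst].
exists s => // u; rewrite lst ffunE goalE.
apply: (le_trans (ler_norm _)).
by rewrite -abszE lez_nat leq_addr.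
Qed.

End Existence.

Definition cover_pebbling_number (G : cgraph) (w : G -> int) : nat :=
  ex_minn (cover_sufficient_exists w).

Definition s_at (G : cgraph) (w : G -> int) (v : G) : int :=
  \sum_u w u * 2 ^+ dist u v.

Definition some_vertex (G : cgraph) : G :=
  enum_val (Ordinal (proj1 (cgraph_connected G))).

(* [int] has no least element, so the iterated maximum is seeded with the value
   at an arbitrary vertex. *)
Definition s_max (G : cgraph) (w : G -> int) : int :=
  \big[Num.max/s_at w (some_vertex G)]_v s_at w v.

Arguments cover_pebbling_number : clear implicits.
Arguments s_max : clear implicits.

(* Main.v *)
(* Lower bound: the potential [\sum_u c u * 2 ^ dist u v] never increases, so a
   stack on [v] must have at least [s_at w v] pebbles.

   Upper bound: root the tree and repeatedly prune the vertex [l] farthest from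
   the root.  If [b] is the excess of [l] over its demand, its neighbour receives
   [b./2] when [0 <= b] and pays [2 * |b|] when [b < 0].  This exchange map
   dominates the concave function [min (2 b) ((b - 1) / 2)], so the excess at
   the root is bounded below by a concave function of the configuration.  A
   configuration being a convex combination of stacks of the same size, it
   suffices to look at stacks; there the successive roundings lose
   1/2 + 1/4 + ... < 1, and the excess at the root is an integer, hence it is
   nonnegative. *)
Require Import Defs.
From mathcomp Require Import all_boot all_order all_algebra.
From mathcomp Require Import boolp.
From mathcomp Require Import zify ring lra.
Local Open Scope ring_scope.

Set Implicit Arguments.
Unset Strict Implicit.
Unset Printing Implicit Defensive.

Import Order.TTheory GRing.Theory Num.Theory.

(** * Graph distance, and the farthest vertex of a tree *)

Section Distance.
Variable G : cgraph.
Implicit Types x y z : G.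

Lemma dist_path x y : exists p : seq G,
  [/\ path (@adj G) x p, last x p = y & size p = dist x y].
Proof.
rewrite /dist; case: ex_minnP => n /existsP[p /andP[pP /eqP pl]] _.
by exists p; rewrite size_tuple.
Qed.

Lemma dist_le x p : path (@adj G) x p -> (dist x (last x p) <= size p)%N.
Proof.
move=> pP; rewrite /dist; case: ex_minnP => n _; apply.
by apply/existsP; exists (in_tuple p); rewrite pP eqxx.
Qed.

Lemma dist_xx x : dist x x = 0%N.
Proof. by apply/eqP; rewrite -leqn0; apply: (@dist_le x [::]). Qed.

Lemma dist_eq0 x y : dist x y = 0%N -> x = y.
Proof. by have [[|z p] [_ <- <-]] := dist_path x y. Qed.

Lemma dist_sym x y : dist x y = dist y x.
Proof.
suff le x' y' : (dist x' y' <= dist y' x')%N by apply/eqP; rewrite eqn_leq !le.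
have [p [pP <- <-]] := dist_path y' x'.
have := @dist_le (last y' p) (rev (belast y' p)).
have -> : last (last y' p) (rev (belast y' p)) = y'.
  by case: p {pP} => //= z p; rewrite rev_cons last_rcons.
rewrite size_rev size_belast; apply.
by rewrite rev_path; under eq_path => a b do rewrite /= adj_sym.
Qed.

Lemma dist_adj x y z : adj y z -> (dist x z <= (dist x y).+1)%N.
Proof.
move=> yz; have [p [pP pl <-]] := dist_path x y.
by have := @dist_le x (rcons p z); rewrite last_rcons size_rcons rcons_path pP pl; apply.
Qed.

Lemma dist_pred x z : z != x -> exists2 y, adj y z & dist x z = (dist x y).+1.
Proof.
move=> zx; have [p [pP pl ps]] := dist_path x z.
case/lastP: p => [|p z'] in pP pl ps; first by rewrite -pl eqxx in zx.
rewrite last_rcons in pl; rewrite pl rcons_path size_rcons in pP ps.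
have [{}pP pz] := andP pP; exists (last x p) => //; apply/eqP.
by rewrite eqn_leq dist_adj //= -ps ltnS dist_le.
Qed.

Let adj_avoiding l := [rel a b : G | [&& adj a b, a != l & b != l]].

(** Every vertex before [y] on a geodesic from [x] is strictly closer to [x] than [l] is, so the
    geodesic misses [l]. *)
Lemma connect_avoiding l x y : y != l -> (dist x y <= dist x l)%N ->
  connect (adj_avoiding l) x y.
Proof.
move: {2}(dist x y) (erefl (dist x y)) => n; elim: n y => [|n IH] y.
  by move/dist_eq0->.
move=> dxy yl le; have yx : y != x.
  by apply/eqP => yx; rewrite yx dist_xx in dxy.
have [z zy dz] := dist_pred yx.
rewrite dz in dxy le; case: dxy => dxy.
have zl : z != l by apply: contraTneq le => ->; rewrite ltnn.
apply: connect_trans (IH z dxy zl (ltnW le)) _.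
by apply: connect1; rewrite /= zy zl yl.
Qed.

(* Otherwise [l] would have two neighbours joined by a path avoiding [l]. *)
Lemma dist_farthest (r l : G) : acyclic G -> l != r -> exists u,
  [/\ adj u l, (dist r u < dist r l)%N & forall x, x != l ->
    (dist r x <= dist r l)%N -> dist x l = (dist x u).+1].
Proof.
move=> acG lr; have [u ul du] := dist_pred lr.
exists u; split=> // [|x xl dx]; first by rewrite du.
have [y yl dy] : exists2 y, adj y l & dist x l = (dist x y).+1.
  by apply: dist_pred; rewrite eq_sym.
have [<- //|uy] := eqVneq y u.
have neq z : adj z l -> z != l by apply: contraTneq => ->; rewrite adj_irrefl.
have csym : connect_sym (adj_avoiding l).
  by apply: sym_connect_sym => a b /=; rewrite adj_sym [(a != l) && _]andbC.
(* Go from [u] to [r], on to [x], then to [y]. Each leg (the first read backwards) is a geodesic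
   ending no farther from its start than [l], so it can avoid [l]. *)
have : connect (adj_avoiding l) u y.
  apply: (@connect_trans _ _ r).
    by rewrite csym connect_avoiding ?neq // du.
  apply: (@connect_trans _ _ x); first exact: connect_avoiding.
  by rewrite connect_avoiding ?neq // dy.
case/connectP=> p0 p0P; case/shortenP: p0P => p pP up _ ylast.
(* Since [u] and [y] differ, the path is nonempty and closing it through [l] gives at least three
   vertices. *)
case: p => [|z p] in pP up ylast; first by rewrite ylast eqxx in uy.
have adjp : path (@adj G) u (z :: p).
  by apply: sub_path pP => a b /= /and3P[].
have lp : l \notin z :: p.
  elim: (z :: p) (u) pP => //= a q IH b /andP[/and3P[_ _ al] /IH].
  by rewrite inE negb_or eq_sym al.
case: (acG [:: l, u, z & p]) => //; apply/andP; split.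
  have -> : cycle (@adj G) [:: l, u, z & p] =
      adj l u && path (@adj G) u (rcons (z :: p) l) by [].
  by rewrite rcons_path -ylast yl adj_sym ul adjp.
by rewrite [uniq _]/= inE negb_or lp (eq_sym l) neq // -/(uniq (u :: z :: p)) up.
Qed.
End Distance.

(** * Pebbling moves and the lower bound *)

Section Pebbling.
Variable G : cgraph.
Implicit Types (c : config G) (u v x : G).

Definition reach c c' :=
  exists2 s : seq (config G), path (@pebbling_move G) c s & last c s = c'.

Lemma reach_refl c : reach c c.
Proof. by exists [::]. Qed.

Lemma reach_trans c1 c2 c3 : reach c1 c2 -> reach c2 c3 -> reach c1 c3.
Proof.
move=> [s sP <-] [t tP <-]; exists (s ++ t); last by rewrite last_cat.
by rewrite cat_path sP.
Qed.

Lemma reach_edge c u v k : adj u v -> (k.*2 <= c u)%N ->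
  reach c [ffun x => (c x - (x == u) * k.*2 + (x == v) * k)%N].
Proof.
move=> uv; elim: k => [|k IH] kc.
  exists [::] => //=; apply/ffunP => x; rewrite ffunE; lia.
have uNv : u != v by apply: contraTneq uv => ->; rewrite adj_irrefl.
apply: reach_trans (IH _) _; first by lia.
set c1 := finfun _; set c2 := finfun _.
exists [:: c2] => //=; rewrite andbT; apply/existsP; exists u.
apply/existsP; exists v; rewrite uv !ffunE eqxx (negbTE uNv) /=.
apply/andP; split; first by lia.
apply/eqP/ffunP => x; rewrite !ffunE.
have [->|xu] := eqVneq x u; first by rewrite (negbTE uNv); lia.
by case: (x == v); lia.
Qed.

(* A move away from [v] at worst doubles the weight of the single pebble that
   survives out of two. *)
Lemma reach_potential v c c' : reach c c' ->
  (\sum_u c' u * 2 ^ dist u v <= \sum_u c u * 2 ^ dist u v)%N.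
Proof.
case=> s + <-; elim: s c => //= c1 s IH c /andP[/existsP[a /existsP[b]]].
case/and3P=> ab ca /eqP c1E /IH/leq_trans; apply.
have aNb : a != b by apply: contraTneq ab => ->; rewrite adj_irrefl.
rewrite (bigD1 a) // (bigD1 b) 1?eq_sym //= [leqRHS](bigD1 a) //.
rewrite [X in (_ <= _ + X)%N](bigD1 b) 1?eq_sym //= c1E !ffunE !eqxx.
rewrite (negbTE aNb) [b == a]eq_sym (negbTE aNb).
rewrite [X in (_ + (_ + X) <= _)%N](eq_bigr (fun x => c x * 2 ^ dist x v)%N); last first.
  by move=> x /andP[/negbTE xa /negbTE xb]; rewrite !ffunE xa xb subn0 addn0.
rewrite !addnA leq_add2r.
have : (2 ^ dist b v <= 2 * 2 ^ dist a v)%N.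
  by rewrite -expnS leq_exp2l // ![dist _ v]dist_sym dist_adj.
by nia.
Qed.

Lemma cover_sufficient_ge (w : G -> int) k v :
  cover_sufficient w k -> s_at w v <= k%:Z.
Proof.
pose c : config G := [ffun x => (k * (x == v))%N].
have sumc F : (\sum_u c u * F u = k * F v)%N.
  rewrite (bigD1 v) //= big1 ?ffunE ?eqxx ?muln1 ?addn0 // => x xv.
  by rewrite ffunE (negbTE xv) muln0.
case/(_ c) => [|s sP cov].
  by have := sumc (fun=> 1%N); under eq_bigr do rewrite muln1; rewrite muln1.
have : reach c (last c s) by exists s.
move/(reach_potential v); rewrite sumc dist_xx muln1 => le.
apply: le_trans (_ : (\sum_u last c s u * 2 ^ dist u v)%:Z <= _); last by rewrite lez_nat.
rewrite /s_at -natz natr_sum; apply: ler_sum => u _.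
by rewrite natrM natrX ler_wpM2r ?exprn_ge0 // natz cov.
Qed.
End Pebbling.

(** * Upper bound by pruning *)

(** Transfers the invariant from a pruned vertex with excess [b], demand [D] and weight [L] to its
    neighbour, where the remaining demand counts as [A]. The two conclusions match the two branches
    of the exchange map; the new loss is half the old one plus 1/2 for rounding. *)
Lemma excess_step (D A th L b : rat) :
  1 <= D -> 1 <= A -> th < 1 -> 0 <= L <= 1 ->
  L * (D + 2 * A - th) <= b + D ->
  L * (2 * D + A - (th + 1) / 2) <= 2 * b + 2 * D /\
  L * (2 * D + A - (th + 1) / 2) <= (b - 1) / 2 + 2 * D.
(* [H1] and [H2] are twice the slack left after multiplying the hypothesis by 2 and by 1/2
   respectively. *)
Proof.
move=> D1 A1 th1 /andP[L0 L1] H.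
have H1 : 0 <= L * (6 * A - 3 * th + 1) by apply: mulr_ge0 L0 _; clear -A1 th1; lra.
have H2 : 0 <= (1 - L) * (3 * D - 1) by apply: mulr_ge0; lra.
by split; lra.
Qed.

(* [S] is what remains of the tree.  [L x] is the total weight, in the convex
   combination, of the stacks whose surplus now sits at [x]; [D x] is the demand
   at [x] plus that of the pruned subtrees hanging from it; [th] is the rounding
   loss so far. *)
Lemma reach_cover_subtree (T : tree) (r : T) n : forall (S : {set T}) (c : config T)
    (w D : T -> nat) (L : T -> rat) (th : rat),
  #|S| = n.+1 ->
  (forall x y, x \in S -> y \notin S -> (dist r x <= dist r y)%N) ->
  (forall x, x \in S -> (0 < D x)%N) ->
  (forall x, x \in S -> 0 <= L x) -> \sum_(x in S) L x = 1 -> th < 1 ->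
  (forall x, x \in S -> L x * ((\sum_(y in S) D y * 2 ^ dist y x)%:R - th)
     <= (c x)%:R - (w x)%:R + (D x)%:R) ->
  exists2 c', reach c c' & forall x,
    if x \in S then (w x <= c' x)%N else (c x <= c' x)%N.
Proof.
elim: n => [|n IH] S c w D L th cardS Sr D0 L0 L1 th1 H.
  have [x Sx] := cards1P (introT eqP cardS).
  exists c; first exact: reach_refl.
  move=> y; rewrite Sx inE; have [->|//] := eqVneq y x.
  have xS : x \in S by rewrite Sx inE.
  (* With [L x = 1] the demand cancels and leaves [w x - c x <= th < 1]; integrality gives
     [w x <= c x]. *)
  have := H x xS; move: L1; rewrite Sx !big_set1 dist_xx muln1 => ->.
  rewrite mul1r => le; rewrite leqNgt; apply/negP => lt.
  have : (c x).+1%:R <= (w x)%:R :> rat by rewrite ler_nat.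
  by rewrite -natr1; lra.
have rS : r \in S.
  have [x xS] : exists x, x \in S by apply/set0Pn; rewrite -card_gt0 cardS.
  case: (boolP (r \in S)) => // rNS; have := Sr x r xS rNS.
  by rewrite dist_xx leqn0 => /eqP/dist_eq0 rx; rewrite rx xS in rNS *.
have [l lS lmax] : exists2 l, l \in S & forall x, x \in S -> (dist r x <= dist r l)%N.
  by have [l lS lmax] := arg_maxnP (dist r) rS; exists l.
have lr : l != r.
  apply/eqP => lr; rewrite lr dist_xx in lmax.
  have : S \subset [set r].
    apply/subsetP => x /lmax; rewrite leqn0 => /eqP/dist_eq0 <-.
    by rewrite inE.
  by move/subset_leq_card; rewrite cards1 cardS.
have [u [ul dul dl]] := dist_farthest (@tree_acyclic T) lr.
have uS : u \in S.
  by case: (boolP (u \in S)) => // uNS; have := Sr l u lS uNS; rewrite leqNgt dul.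
have uNl : u != l by apply: contraTneq ul => ->; rewrite adj_irrefl.
pose S' := S :\ l.
have inS' x : (x \in S') = (x != l) && (x \in S) by rewrite !inE.
have uS' : u \in S' by rewrite inS' uNl.
have dl' x : x \in S' -> dist x l = (dist x u).+1.
  by rewrite inS' => /andP[xl xS]; apply: dl => //; apply: lmax.
(* Geodesics from [l] into [S'] start with the edge to [u], so demand [D l] at [l] is worth
   [2 * D l] at [u], and the weighted sums seen from [S'] do not change. *)
pose D' x := (D x + (x == u) * (2 * D l))%N.
pose L' x : rat := L x + (x == u)%:R * L l.
pose A := (\sum_(y in S') D y * 2 ^ dist y u)%N.
have sumS F : (\sum_(y in S) F y = F l + \sum_(y in S') F y)%N.
  rewrite (bigD1 l) //=; congr addn; apply: eq_bigl => y.
  by rewrite inS' andbC.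
have sumSl : (\sum_(y in S) D y * 2 ^ dist y l = D l + 2 * A)%N.
  rewrite sumS dist_xx muln1 big_distrr /=; congr addn; apply: eq_bigr => y yS.
  by rewrite dl' // expnS mulnCA.
have sumSD x : x \in S' -> (\sum_(y in S) D y * 2 ^ dist y x =
    \sum_(y in S') D' y * 2 ^ dist y x)%N.
  move=> xS; rewrite sumS (bigD1 u) //= [RHS](bigD1 u) //= /D' eqxx.
  rewrite [X in (_ = _ + X)%N](eq_bigr (fun y => D y * 2 ^ dist y x)%N).
    by rewrite [dist l x]dist_sym dl' // expnS [dist x u]dist_sym mul1n; clear; ring.
  by move=> y /andP[_ /negbTE->]; rewrite addn0.
have sumSu : (\sum_(y in S) D y * 2 ^ dist y u = 2 * D l + A)%N.
  by rewrite sumS [dist l u]dist_sym dl' // dist_xx expn1 mulnC.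
have Ll1 : 0 <= L l <= 1.
  rewrite L0 //= -L1 (bigD1 l) //= lerDl sumr_ge0 // => x /andP[xS _].
  exact: L0.
have D1 x : x \in S -> 1 <= (D x)%:R :> rat by move=> xS; rewrite ler1n D0.
have A1 : 1 <= A%:R :> rat.
  rewrite ler1n /A (bigD1 u) //= dist_xx muln1.
  by rewrite (leq_trans (D0 u uS)) ?leq_addr.
pose th' : rat := (th + 1) / 2.
have thth' : th <= th' by rewrite /th'; lra.
(* Both signs of the excess at [l] alter the data only at [u], so a single inequality there
   suffices; elsewhere the invariant weakens because [th <= th']. *)
have {}IH (c1 : config T) (w1 : T -> nat) :
    (forall x, x \in S' -> x != u -> c1 x = c x /\ w1 x = w x) ->
    L l * (2 * (D l)%:R + A%:R - th') <=
      ((c1 u)%:R - (w1 u)%:R) - ((c u)%:R - (w u)%:R) + 2 * (D l)%:R ->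
  exists2 c', reach c1 c' & forall x,
    if x \in S' then (w1 x <= c' x)%N else (c1 x <= c' x)%N.
  move=> cw1 cwu; apply: (IH S' c1 w1 D' L' th') => //.
  - by apply/eqP; move: cardS; rewrite (cardsD1 l) lS /= add1n => -[->].
  - move=> x y; rewrite !inS' negb_and negbK => /andP[xl xS].
    case/orP=> [/eqP->|]; [exact: lmax | exact: Sr].
  - by move=> x; rewrite inS' /D' => /andP[_ xS]; rewrite ltn_addr ?D0.
  - move=> x; rewrite inS' /L' => /andP[_ xS].
    by rewrite addr_ge0 ?L0 // mulr_ge0 ?L0.
  - rewrite -[RHS]L1 /L' big_split /= [RHS](bigD1 l) //= addrC; congr (_ + _).
      rewrite (bigD1 u) //= eqxx mulr1n mul1r big1 ?addr0 // => x /andP[_ /negbTE->].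
      by rewrite mulr0n mul0r.
    by apply: eq_bigl => x; rewrite inS' andbC.
  - by rewrite /th'; lra.
  move=> x xS'; have /andP[xl xS] : (x != l) && (x \in S) by rewrite -inS'.
  rewrite -sumSD // /L' /D'; have := H x xS.
  have [->|xu] := eqVneq x u; last first.
    have [-> ->] := cw1 x xS' xu.
    rewrite mulr0n mul0r addr0 mul0n addn0; apply: le_trans.
    by rewrite ler_wpM2l ?L0 // lerB.
  rewrite sumSu mulr1n mul1r mul1n !natrD addr0 => Hu.
  have Hu' : L u * ((D l)%:R + (D l)%:R + A%:R - th') <= (c u)%:R - (w u)%:R + (D u)%:R.
    by apply: le_trans Hu; rewrite ler_wpM2l ?L0 // lerB.
  rewrite mulr_natl mulr2n in cwu; rewrite mulrDl; apply: le_trans (lerD Hu' cwu) _.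
  rewrite le_eqVlt; apply/orP; left; apply/eqP; ring.
have Hl := H l lS; rewrite sumSl natrD natrM in Hl.
have [ineq1 ineq2] := excess_step (D1 l lS) A1 th1 Ll1 Hl.
case: (leqP (w l) (c l)) => [le|lt].
  (* Surplus: push [e] pebbles to [u] before recursing. At least [w l] stay on [l], and the
     recursion never lowers the count outside [S']. *)
  pose e := ((c l - w l)./2)%N.
  have lu : adj l u by rewrite adj_sym.
  have ecl : (e.*2 <= c l)%N by rewrite /e; clear -le; lia.
  have := reach_edge lu ecl; set c1 := finfun _ => cc1.
  have [||c' c1c' c'P] := IH c1 w.
  - move=> x; rewrite inS' => /andP[/negbTE xl _] /negbTE xu.
    by rewrite ffunE xl xu subn0 addn0.
  - rewrite ffunE eqxx (negbTE uNl) mul1n subn0 natrD.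
    apply: le_trans ineq2 _.
    have : (c l)%:R <= (w l + 2 * e + 1)%:R :> rat.
      by rewrite ler_nat /e; clear -le; lia.
    by rewrite !natrD addr0; lra.
  exists c'; first exact: reach_trans cc1 c1c'.
  move=> x; have := c'P x; rewrite inS'.
  have [->|xl] /= := eqVneq x l.
    by rewrite lS ffunE eqxx eq_sym (negbTE uNl) /e; clear -le; lia.
  case: ifP => // _; rewrite ffunE (negbTE xl) subn0; exact/leq_trans/leq_addr.
(* Deficit: recurse first with the demand at [u] raised by [2 * e], then spend that reserve to bring
   [e] pebbles to [l]. *)
pose e := (w l - c l)%N.
have [||c' cc' c'P] := IH c (fun x => w x + (x == u) * e.*2)%N.
- by move=> x _ /negbTE->; rewrite addn0.
- apply: le_trans ineq1 _.
  have -> : (w l)%:R = (c l)%:R + e%:R :> rat.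
    by rewrite -natrD /e subnKC // ltnW.
  by rewrite eqxx mul1n natrD -mul2n natrM; lra.
have ecu : (e.*2 <= c' u)%N.
  by have := c'P u; rewrite uS' eqxx mul1n; apply/leq_trans/leq_addl.
exists [ffun x => (c' x - (x == u) * e.*2 + (x == l) * e)%N].
  exact: reach_trans cc' (reach_edge ul ecu).
move=> x; rewrite ffunE; have := c'P x; rewrite inS'.
have [->|xl] /= := eqVneq x l.
  by rewrite lS eq_sym (negbTE uNl) /e; clear -lt; lia.
rewrite mul0n addn0; have [xu|_] := eqVneq x u; last first.
  by rewrite mul0n addn0 subn0.
by rewrite xu uS mul1n; clear; lia.
Qed.

Theorem theorem7 (T : tree) (w : T -> int) (w_pos : forall v : T, 0 < w v) :
  (cover_pebbling_number T w)%:Z = s_max T w.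
Proof.
pose W v := `|w v|%N.
have wW v : w v = (W v)%:Z by rewrite /W gez0_abs // ltW.
pose s v := (\sum_u W u * 2 ^ dist u v)%N.
have s_atE v : s_at w v = (s v)%:Z.
  rewrite /s_at /s -[RHS]natz natr_sum; apply: eq_bigr => u _.
  by rewrite wW natrM natrX (natz (W u)).
have s_le v : s_at w v <= s_max T w by apply: le_bigmax.
rewrite /cover_pebbling_number; case: ex_minnP => k /asboolP kP kmin.
apply/eqP; rewrite eq_le; apply/andP; split; last first.
  by apply/bigmax_leP; split=> [|v _]; apply: cover_sufficient_ge.
have [N NE] : exists N : nat, s_max T w = N%:Z.
  exists `|s_max T w|%N; rewrite gez0_abs //.
  by apply: le_trans (s_le (some_vertex T)); rewrite s_atE.
rewrite NE lez_nat; apply: kmin; apply/asboolP => c cN.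
have sN v : (s v <= N)%N by rewrite -lez_nat -s_atE -NE.
have W0 v : (0 < W v)%N by rewrite -ltz_nat -wW.
have s0 v : (0 < s v)%N by rewrite /s (bigD1 v) //= dist_xx muln1 ltn_addr.
pose r := some_vertex T.
have N0 : 0 < N%:R :> rat by rewrite ltr0n (leq_trans (s0 r)).
have T0 : (0 < #|T|)%N by case: (cgraph_connected T).
(* [c] is the convex combination, with weights [c x / N], of stacks of size [N]. With no loss yet,
   the invariant at [x] reads [c x / N * s x <= c x], which is [s x <= N] scaled. *)
have [|||||||c' [p pP pl] c'P] := @reach_cover_subtree T r #|T|.-1 [set: T] c W W
    (fun x => (c x)%:R / N%:R) 0 => //.
- by rewrite cardsT prednK.
- by move=> x y _; rewrite inE.
- by move=> x _; rewrite divr_ge0.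
- rewrite -mulr_suml -natr_sum -[X in X%:R]/(\sum_(x in [set: T]) c x)%N.
  under eq_bigl do rewrite inE.
  by rewrite -/(config_size c) cN divff // gt_eqF.
- move=> x _; rewrite subr0 subrK; under eq_bigl do rewrite inE.
  by rewrite mulrAC ler_pdivrMr // ler_wpM2l // ler_nat sN.
by exists p => // v; have := c'P v; rewrite inE pl wW lez_nat.
Qed.
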